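(* If $L$ is a zero-dimensional compact $F$-space, then $L$ is not a Boolean image of a compact connected space. In particular, neither $\beta\omega$ nor any extremally disconnected compact space is a Boolean image of a compact connected space.
   Context: All compact spaces are Hausdorff; ''zero-dimensional'' means having a base of clopen sets. A compact space is an $F$-space if any two disjoint open $F_\sigma$ subsets of it have disjoint closures. A space is extremally disconnected if the closure of every open set is open. $\beta\omega$ is the Čech–Stone compactification of the discrete space $\omega$. A pseudoclopen of a compact space $K$ is a pair $a=(a^-,a^+)$ with $a^-\subset K$ closed, $a^+\subset K$ open and $a^-\subset a^+$. Let $\mathcal{G}$ be a family of subsets of a set $X$. A bijection $\phi$ from $\mathcal{G}$ onto a family of pseudoclopens of $K$ is an isomorphism if for all $n,m$ and all distinct $a_1,\ldots,a_n,b_1,\ldots,b_m\in\mathcal{G}$: (1) if $\bigcap_{i\le n}a_i\setminus\bigcup_{j\le m}b_j=\emptyset$ then $\bigcap_{i\le n}\phi(a_i)^+\setminus\bigcup_{j\le m}\phi(b_j)^-=\emptyset$; (2) if $\bigcap_{i\le n}\phi(a_i)^-\setminus\bigcup_{j\le m}\phi(b_j)^+=\emptyset$ then $\bigcap_{i\le n}a_i\setminus\bigcup_{j\le m}b_j=\emptyset$. (Here $n$ or $m$ may be $0$; empty intersections are $X$, respectively $K$.) A zero-dimensional compact space $L$ is a Boolean image of a compact space $K$ if there is a family $\mathcal{G}$ of clopen subsets of $L$ (regarded as subsets of $X=L$) which separates the points of $L$ (for all $x\neq y$ in $L$ there is $a\in\mathcal{G}$ with $|a\cap\{x,y\}|=1$)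 and which is isomorphic to a family of pseudoclopens of $K$.
   Formalization: The space L (and the extremally disconnected compact space) is assumed infinite: every nonempty finite discrete space is a zero-dimensional compact F-space, extremally disconnected, and is a Boolean image of [0,1], so the claim fails for it. *)

(* Defs.v *)
From HB Require Import structures.
From mathcomp Require Import all_boot all_order.
From mathcomp Require Import boolp classical_sets functions cardinality.
From mathcomp Require Import topology borel_hierarchy.

Set Implicit Arguments.
Unset Strict Implicit.
Unset Printing Implicit Defensive.

Local Open Scope classical_set_scope.
Local Open Scope card_scope.

Definition compact_T2 (T : topologicalType) : Prop :=
  compact [set: T] /\ hausdorff_space T.

(* This is not the library's [zero_dimensional], which only asks that distinct
   points be separated by a clopen set. *)
Definition has_clopen_basis (T : topologicalType) : Prop :=
  exists2 B : set (set T), basis B & B `<=` clopen.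

(* Meant for compact Hausdorff T. *)
Definition F_space (T : topologicalType) : Prop :=
  forall U V : set T, open U -> Fsigma U -> open V -> Fsigma V ->
    U `&` V = set0 -> closure U `&` closure V = set0.

Definition extremally_disconnected (T : topologicalType) : Prop :=
  forall U : set T, open U -> open (closure U).

(* (B, e) is the Cech-Stone compactification of X: a compact Hausdorff space
   with a dense embedding e of X, to which every continuous map from X to a
   compact Hausdorff space extends (uniquely, by density). *)
Definition cech_stone (X B : topologicalType) (e : X -> B) : Prop :=
  [/\ compact_T2 B,
      [/\ continuous e, injective e &
          forall U : set X, open U -> exists2 V : set B, open V & e @^-1` V = U],
      dense (range e) &
      forall (C : topologicalType) (f : X -> C), compact_T2 C -> continuous f ->
        exists2 g : B -> C, continuous g & forall x, g (e x) = f x].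

(* The pair a stands for (a^-, a^+) = (a.1, a.2). *)
Definition pseudoclopen (K : topologicalType) (a : set K * set K) : Prop :=
  [/\ closed a.1, open a.2 & a.1 `<=` a.2].

(* a_1, ..., a_n, b_1, ..., b_m are pairwise distinct. *)
Definition all_distinct (T : Type) (n m : nat) (a : 'I_n -> T) (b : 'I_m -> T)
    : Prop :=
  [/\ injective a, injective b & forall i j, a i <> b j].

(* For n = 0 the intersections below are [set: X] and [set: K]. *)
Definition pseudoclopen_iso (X : Type) (K : topologicalType)
    (G : set (set X)) (H : set (set K * set K))
    (phi : set X -> set K * set K) : Prop :=
  set_bij G H phi /\
  forall (n m : nat) (a : 'I_n -> set X) (b : 'I_m -> set X),
    (forall i, G (a i)) -> (forall j, G (b j)) -> all_distinct a b ->
    ((\bigcap_i a i) `\` (\bigcup_j b j) = set0 ->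
     (\bigcap_i (phi (a i)).2) `\` (\bigcup_j (phi (b j)).1) = set0) /\
    ((\bigcap_i (phi (a i)).1) `\` (\bigcup_j (phi (b j)).2) = set0 ->
     (\bigcap_i a i) `\` (\bigcup_j b j) = set0).

Definition separates_points (X : Type) (G : set (set X)) : Prop :=
  forall x y : X, x <> y -> exists2 a, G a & (a `&` [set x; y]) #= `I_1.

Definition boolean_image (L K : topologicalType) : Prop :=
  exists (G : set (set L)) (H : set (set K * set K))
         (phi : set L -> set K * set K),
    [/\ G `<=` clopen, separates_points G, H `<=` @pseudoclopen K &
        pseudoclopen_iso G H phi].

(* Main.v *)
(* Let [phi] be an isomorphism from [G] onto pseudoclopens of the connected
   space [K]. For [a] in [G] other than the empty set and [L], condition (2) and
   connectedness give a point [x] of [phi(a)^+] outside [phi(a)^-]; then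
   condition (1) and compactness of [L] turn the position of [x] relative to the
   sets [phi(b)] into points [y] in [a] and [z] outside [a] that no other member
   of [G] separates. With infinitely many distinct [a_n] in [G] this gives pairs
   [(y_n, z_n)] which every member of [G] separates at most once, so that [y_n]
   and [z_n] have common cluster points. Near such a point [p] one chooses
   recursively such pairs with pairwise disjoint clopen neighbourhoods; the
   unions of the neighbourhoods of the first and of the second components are
   disjoint open F_sigma sets with a common point in their closures, which an
   F-space forbids. *)
Require Import Defs.
From HB Require Import structures.
From mathcomp Require Import all_boot all_order.
From mathcomp Require Import finmap.
From mathcomp Require Import boolp classical_sets functions cardinality.
From mathcomp Require Import topology borel_hierarchy.

Set Implicit Arguments.
Unset Strict Implicit.
Unset Printing Implicit Defensive.

Local Open Scope classical_set_scope.

(** * Cluster points and separating families in compact spaces *)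

Lemma compact_seq_cluster (T : topologicalType) (u : nat -> T) :
  compact [set: T] ->
  exists p : T, forall k B, nbhs p B -> exists2 n, (k <= n)%N & B (u n).
Proof.
move=> cT.
have [p [_ cp]] := cT (fmap u \oo) _ filterT.
exists p => k B pB.
have Fk : fmap u \oo (u @` [set n | (k <= n)%N]).
  by exists k => // n kn; exists n.
by have [_ [[n kn <-] Bn]] := cp _ _ Fk pB; exists n.
Qed.

Lemma separates_pointsP (X : Type) (G : set (set X)) (x y : X) :
  separates_points G -> x <> y -> exists2 a, G a & ~ (a x <-> a y).
Proof.
move=> sG xy; have [a Ga /eq_cardSP [w [aw xyw]]] := sG _ _ xy.
rewrite II0 card_eq0 => /eqP E.
exists a => // axy.
have [ax ay] : a x /\ a y by case: xyw aw => -> aw; split => //; apply/axy.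
have mem t : a t -> [set x; y] t -> t = w.
  move=> at_ xyt; apply: contrapT => tw.
  have : (a `&` [set x; y] `\ w) t by [].
  by rewrite E.
by apply: xy; rewrite (mem x ax (or_introl erefl)); rewrite (mem y ay (or_intror erefl)).
Qed.

Lemma separates_points_clopen (L : topologicalType) (G : set (set L)) (x y : L) :
  separates_points G -> G `<=` clopen -> x <> y ->
  exists s, [/\ clopen s, s x & ~ s y].
Proof.
move=> sG Gc xy; have [a Ga nxy] := separates_pointsP sG xy.
have ca := Gc _ Ga.
have [ax|nax] := pselect (a x).
  by exists a; split=> // ay; apply: nxy.
exists (~` a); split => //; first exact: clopenC.
by apply: contrapT => nny; apply: nny => /= ay; apply: nxy; split.
Qed.

(** A cluster point [(q, r)] of the pairs [(u n, v n)] lies on the diagonal: a member of [G]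
    separating [q] from [r] would separate [u n] from [v n] for arbitrarily large [n]. *)
Lemma compact_common_cluster (L : topologicalType) (G : set (set L))
    (u v : nat -> L) :
  compact [set: L] -> separates_points G -> G `<=` clopen ->
  (forall b, G b -> exists k, forall n, (k <= n)%N -> b (u n) <-> b (v n)) ->
  exists p : L, forall k B, nbhs p B ->
    exists n, [/\ (k <= n)%N, B (u n) & B (v n)].
Proof.
move=> cL sG Gc uv.
have cLL : compact [set: L * L] by rewrite -setXTT; exact: compact_setX.
have [[q r] qr] := @compact_seq_cluster (L * L)%type (fun n => (u n, v n)) cLL.
have E : q = r.
  apply: contrapT => nqr; have [b Gb nb] := separates_pointsP sG nqr.
  have [ob cb] := Gc _ Gb.
  have cbo : open (~` b) by exact: closed_openC.
  have [k kb] := uv _ Gb.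
  have nb1 c d : open c -> open d -> c q -> d r ->
      exists n, [/\ (k <= n)%N, c (u n) & d (v n)].
    move=> oc od cq dr.
    have [|n kn [] /= cn dn] := qr k (c `*` d); last by exists n.
    by exists (c, d) => //; split; exact: open_nbhs_nbhs.
  have [bq|nbq] := pselect (b q).
    have [|n [kn bn]] := nb1 b (~` b) ob cbo bq; first by move=> br; apply: nb.
    by apply; apply/kb.
  have [br|nbr] := pselect (b r); last by apply: nb; split.
  have [n [kn nbn bn]] := nb1 (~` b) b cbo ob nbq br.
  by apply: nbn; apply/kb.
exists q => k B qB.
have [|n kn [] /= un vn] := qr k (B `*` B); last by exists n.
by exists (B, B) => //; split => //; rewrite -E.
Qed.

(** * Sequences of pairs in a compact F-space *)

Lemma bigcup_clopen_Fsigma (T : topologicalType) (A : nat -> set T) :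
  (forall n, clopen (A n)) -> open (\bigcup_n A n) /\ Fsigma (\bigcup_n A n).
Proof.
move=> cA; split; first by apply: bigcup_open => n _; have [] := cA n.
by exists A => // n; have [] := cA n.
Qed.

Lemma F_space_no_common_cluster (L : topologicalType) (G : set (set L))
    (A B : nat -> set L) (u v : nat -> L) :
  compact [set: L] -> F_space L -> separates_points G -> G `<=` clopen ->
  (forall n, clopen (A n)) -> (forall n, clopen (B n)) ->
  (forall m n, A m `&` B n = set0) ->
  (forall n, A n (u n)) -> (forall n, B n (v n)) ->
  (forall b, G b -> exists k, forall n, (k <= n)%N -> b (u n) <-> b (v n)) ->
  False.
Proof.
move=> cL FL sG Gc cA cB AB Au Bv uv.
have [p pP] := compact_common_cluster cL sG Gc uv.
have [oU fU] := bigcup_clopen_Fsigma cA.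
have [oV fV] := bigcup_clopen_Fsigma cB.
have UV : \bigcup_n A n `&` \bigcup_n B n = set0.
  apply/seteqP; split=> // x [[m _ Ax] [n _ Bx]].
  by rewrite -(AB m n).
have := FL _ _ oU fU oV fV UV; apply/eqP/set0P; exists p; split=> D pD.
  by have [n [_ un vn]] := pP 0 D pD; exists (u n); split => //; exists n.
by have [n [_ un vn]] := pP 0 D pD; exists (v n); split => //; exists n.
Qed.

(** A pair assembled from two of the given pairs is separated by two of the [a i], so a whole tail
    of exceptions is allowed rather than a single one. *)
Definition agree_off_tail (X : Type) (G : set (set X)) (a : nat -> set X) (k : nat)
    (u v : X) : Prop :=
  forall b, G b -> (forall i, (k <= i)%N -> b <> a i) -> b u <-> b v.

(** Pairs are chosen inside a shrinking clopen neighbourhood [W] of [p]; each is enclosed in two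
    disjoint clopen sets missing [p], which are then removed from [W]. *)
Lemma disjoint_clopen_pairs (L : topologicalType) (G : set (set L))
    (Q : nat -> L -> L -> Prop) (p : L) :
  separates_points G -> G `<=` clopen ->
  (forall k W, clopen W -> W p -> exists u v,
    [/\ Q k u v, u <> v, u <> p /\ v <> p & W u /\ W v]) ->
  exists (A B : nat -> set L) (u v : nat -> L),
    [/\ forall n, clopen (A n), forall n, clopen (B n),
        forall m n, A m `&` B n = set0
      & forall n, [/\ A n (u n), B n (v n) & Q n (u n) (v n)]].
Proof.
move=> sG Gc QP.
(* The premises on [W] sit inside [P], with empty sets as default witness, so that choice yields a
   step function defined on all [(k, W)]. *)
pose P k W (t : set L * set L * (L * L)) :=
  clopen W -> W p ->
  [/\ clopen t.1.1, clopen t.1.2, t.1.1 `&` t.1.2 = set0,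
      [/\ t.1.1 `<=` W, t.1.2 `<=` W, ~ t.1.1 p & ~ t.1.2 p]
    & [/\ t.1.1 t.2.1, t.1.2 t.2.2 & Q k t.2.1 t.2.2]].
have step kW : exists t, P kW.1 kW.2 t.
  case: kW => k W; have [[cW Wp]|nW] := pselect (clopen W /\ W p); last first.
    by exists (set0, set0, (p, p)) => cW Wp; case: nW.
  have [u [v [Quv uv [up vp] [Wu Wv]]]] := QP k W cW Wp.
  have [s [cs su nsv]] := separates_points_clopen sG Gc uv.
  have [c [cc cu ncp]] := separates_points_clopen sG Gc up.
  have [d [cd dv ndp]] := separates_points_clopen sG Gc vp.
  exists (W `&` s `&` c, W `&` ~` s `&` d, (u, v)) => _ _; split => //=.
  - by apply: clopenI => //; apply: clopenI.
  - by apply: clopenI => //; apply: clopenI => //; exact: clopenC.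
  - by apply/seteqP; split => // x [[[_ sx] _] [[_ nsx] _]].
  - by split; [move=> x [[]]|move=> x [[]]|case|case].
have [f fP] := choice step.
pose W := fix W n := if n is m.+1
  then W m `&` ~` ((f (m, W m)).1.1 `|` (f (m, W m)).1.2) else [set: L].
have WP n : clopen (W n) /\ W n p.
  elim: n => [|n [cW Wp]]; first by split => //; exact: clopenT.
  have [cA cB _ [_ _ nA nB] _] := fP (n, W n) cW Wp.
  split; last by split => // -[].
  by apply: clopenI => //; apply: (clopenC set0); exact: clopenU.
have tP n := fP (n, W n) (WP n).1 (WP n).2.
have Wle m n : (m <= n)%N -> W n `<=` W m.
  elim: n => [|n IH]; first by rewrite leqn0 => /eqP ->.
  rewrite leq_eqVlt => /orP[/eqP -> //|mn] x [Wx _].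
  exact: (IH mn).
exists (fun n => (f (n, W n)).1.1), (fun n => (f (n, W n)).1.2),
  (fun n => (f (n, W n)).2.1), (fun n => (f (n, W n)).2.2).
split=> [n|n|m n|n]; try by have [] := tP n.
apply/seteqP; split=> // x [Ax Bx].
have [_ _ AmBm [AW _ _ _] _] := tP m.
have [_ _ _ [_ BW _ _] _] := tP n.
(* Of two different stages, the sets of the later one lie in a [W] from which those of the earlier
   one have been removed. *)
case: (ltngtP m n) => [mn|nm|E].
- have [_ []] : W m.+1 x by apply: (Wle _ _ mn); exact: BW.
  by left.
- have [_ []] : W n.+1 x by apply: (Wle _ _ nm); exact: AW.
  by right.
- by move: Bx; rewrite -E => Bx; rewrite -AmBm.
Qed.

(* The cluster point [p] of the pairs may itself lie in infinitely many pairs;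
   two such pairs then provide a new pair avoiding [p]. *)
Lemma pairs_avoiding_cluster (L : topologicalType) (G : set (set L))
    (a : nat -> set L) (y z : nat -> L) :
  compact [set: L] -> separates_points G -> G `<=` clopen ->
  injective a -> (forall n, G (a n)) ->
  (forall n, a n (y n)) -> (forall n, ~ a n (z n)) ->
  (forall n b, G b -> b <> a n -> b (y n) <-> b (z n)) ->
  exists p, forall k W, clopen W -> W p -> exists u v,
    [/\ agree_off_tail G a k u v, u <> v, u <> p /\ v <> p & W u /\ W v].
Proof.
move=> cL sG Gc aI Ga ay az yz.
have [|p pP] := @compact_common_cluster L G y z cL sG Gc.
  move=> b Gb; have [[n ->]|nb] := pselect (exists n, b = a n).
    exists n.+1 => m nm; apply: yz => // /aI E.
    by rewrite E ltnn in nm.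
  by exists 0 => n _; apply: yz => // E; apply: nb; exists n.
exists p => k W [oW _] Wp.
have pW : nbhs p W by exact: open_nbhs_nbhs.
(* When [p] belongs to the [n]-th pair, [w n] is the other point of that pair, and [a n] is the only
   member of [G] separating it from [p] ([pw] below). *)
pose w n := if pselect (y n = p) then z n else y n.
have yzn n : y n <> z n by move=> E; apply: (az n); rewrite -E.
have wp n : w n <> p.
  rewrite /w; case: pselect => //= yp zp; apply: (yzn n).
  by rewrite yp zp.
have pw n : y n = p \/ z n = p -> forall b, G b -> (b p <-> b (w n)) <-> b <> a n.
  move=> ynp b Gb; rewrite /w; case: pselect => yp /=.
    split => [E bE|bn]; last by rewrite -yp; exact: yz.
    by apply: (az n); rewrite -bE; apply/E; rewrite -yp bE.
  case: ynp => // zp; rewrite -zp; split => [E bE|bn].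
    by apply: (az n); rewrite -bE; apply/E; rewrite bE.
  by split=> h; apply/yz.
have Ww n : W (y n) -> W (z n) -> W (w n) by rewrite /w; case: pselect.
have [n [kn Wy Wz]] := pP k W pW.
have [ynp|ynp] := pselect (y n = p \/ z n = p); last first.
  exists (y n), (z n); split => //; last by split => E; apply: ynp; [left|right].
  by move=> b Gb bk; apply: yz => //; exact: bk.
have [m [nm Wy' Wz']] := pP n.+1 W pW.
have km : (k <= m)%N by rewrite (leq_trans kn) // ltnW.
have [ymp|ymp] := pselect (y m = p \/ z m = p); last first.
  exists (y m), (z m); split => //; last by split => E; apply: ymp; [left|right].
  by move=> b Gb bk; apply: yz => //; exact: bk.
have pn := pw n ynp; have pm := pw m ymp.
(* On [G], [w n] agrees with [p] except at [a n], and [w m] except at [a m]. Hence only these two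
   can separate [w n] from [w m], and [a n] does, since [a n <> a m]. *)
exists (w n), (w m); split; [|move=> E|split; exact: wp|by split; exact: Ww].
  move=> b Gb bk.
  have [_ /(_ (bk n kn)) [h1 h2]] := pn b Gb.
  have [_ /(_ (bk m km)) [h3 h4]] := pm b Gb.
  by split => ?; [apply: h3; apply: h2|apply: h1; apply: h4].
have [h _] := pn (a n) (Ga n).
apply: h => //; rewrite E; apply/(pm (a n) (Ga n)) => /aI nE.
by rewrite nE ltnn in nm.
Qed.

Lemma F_space_no_adjacent_pairs (L : topologicalType) (G : set (set L))
    (a : nat -> set L) (y z : nat -> L) :
  compact [set: L] -> F_space L -> separates_points G -> G `<=` clopen ->
  injective a -> (forall n, G (a n)) ->
  (forall n, a n (y n)) -> (forall n, ~ a n (z n)) ->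
  (forall n b, G b -> b <> a n -> b (y n) <-> b (z n)) ->
  False.
Proof.
move=> cL FL sG Gc aI Ga ay az yz.
have [p /(disjoint_clopen_pairs sG Gc) [A [B [u [v [cA cB AB uv]]]]]] :=
  pairs_avoiding_cluster cL sG Gc aI Ga ay az yz.
apply: (@F_space_no_common_cluster L G A B u v) => // [n|n|b Gb].
- by have [] := uv n.
- by have [] := uv n.
have [[n ->]|nb] := pselect (exists n, b = a n).
  (* The [m]-th pair is separated only by sets [a i] with [m <= i], so [a n] separates no pair from
     index [n.+1] on. *)
  exists n.+1 => m nm; have [_ _] := uv m; apply => // i mi /aI E.
  by move: (leq_trans nm mi); rewrite E ltnn.
exists 0 => n _; have [_ _] := uv n; apply => // i _ E.
by apply: nb; exists i.
Qed.

(** * Infinite separating families; extremally disconnected spaces *)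

Lemma separating_infinite (X : Type) (G : set (set X)) :
  infinite_set [set: X] -> separates_points G -> infinite_set G.
Proof.
move=> iX sG fG; apply: iX.
(* A point is determined by the members of [G] containing it, so for finite [G] this map is
   injective into a finite power set. *)
pose S (x : X) := G `&` [set b | b x].
have fS x : finite_set (S x) by exact: finite_setIl.
have -> : [set: X] = (fun x => fset_set (S x)) @^-1` [set` fpowerset (fset_set G)].
  apply/seteqP; split => // x _ /=; rewrite fpowersetE.
  by apply/fsubsetP => b; rewrite !in_fset_set // !inE => -[].
apply: finite_preimage; last exact: finite_fset.
move=> x y _ _ /= E; apply: contrapT => /(separates_pointsP sG) [b Gb []].
have SE t : b t <-> b \in fset_set (S t).
  by rewrite in_fset_set // inE; split => [|[]].
by rewrite !SE E.
Qed.

Lemma extremally_disconnected_F_space (L : topologicalType) :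
  extremally_disconnected L -> F_space L.
Proof.
have sep (A B : set L) : open B -> A `&` B = set0 -> closure A `&` B = set0.
  move=> oB AB; apply/seteqP; split=> // x [Ax Bx].
  by have := Ax B (open_nbhs_nbhs (conj oB Bx)); rewrite AB => -[].
move=> ed U V oU _ oV _ UV; rewrite setIC; apply: (sep); first exact: ed.
by rewrite setIC; exact: sep.
Qed.

(** The indicator of [U] along [e] extends to a continuous [g : B -> bool]. As the range of [e] is
    dense, [g] is true on [U], and [U] is dense in the clopen set where [g] is true. *)
Lemma cech_stone_nat_extremally_disconnected (B : topologicalType)
    (e : nat -> B) :
  cech_stone e -> extremally_disconnected B.
Proof.
move=> [_ _ de ext] U oU.
pose f n : bool := `[< U (e n) >].
have cb : compact_T2 bool by split; [exact: bool_compact|exact: discrete_hausdorff].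
have cf : continuous f by apply/continuousP => *; exact: discrete_open.
have [g cg gf] := ext _ _ cb cf.
have cl b : clopen (g @^-1` [set b]).
  by apply: preimage_clopen => //; split; [exact: discrete_open|exact: discrete_closed].
suff -> : closure U = g @^-1` [set true] by have [] := cl true.
have gU b x : U x -> g x = b -> exists n, f n = b /\ U (e n).
  move=> Ux gx.
  have [|| t [[Un gn] [n _ nE]]] := de (U `&` g @^-1` [set b]).
  - by exists x.
  - by apply: openI => //; have [] := cl b.
  by exists n; move: Un gn; rewrite -nE /= gf.
apply/seteqP; split => [|x /= gx D xD].
  rewrite closureE; apply: smallest_sub; first by have [] := cl true.
  move=> x Ux /=; case E: (g x) => //.
  have [n [/asboolPn fn Un]] := gU _ _ Ux E; by [].
have [|| t [[Dn gn] [n _ nE]]] := de (D^° `&` g @^-1` [set true]).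
- by exists x.
- by apply: openI; [exact: open_interior|have [] := cl true].
exists (e n); move: Dn gn; rewrite -nE /= gf => /interior_subset Dn /asboolP.
by split.
Qed.

(** * From points of [K] to adjacent pairs in [L] *)

(** By condition (1), [x] witnesses that finitely many requirements [b y <-> S b] can be met
    together. Each is a closed condition because [b] is clopen, so compactness of [L] meets them
    all. *)
Lemma pseudoclopen_iso_realize (L K : topologicalType) (G : set (set L))
    (H : set (set K * set K)) (phi : set L -> set K * set K) (x : K)
    (S : set (set L)) :
  compact [set: L] -> G `<=` clopen -> pseudoclopen_iso G H phi ->
  (forall b, G b -> S b -> (phi b).2 x) ->
  (forall b, G b -> ~ S b -> ~ (phi b).1 x) ->
  exists y, forall b, G b -> b y <-> S b.
Proof.
move=> cL Gc [_ iso] Sx nSx.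
pose f b : set L := [set y | b y <-> S b].
suff [y Gy] : \bigcap_(b in G) f b !=set0 by exists y.
suff finf : finI G f.
  have FF := finI_filter finf.
  have [y [_ yP]] := cL _ FF filterT.
  exists y => b Gb; have [ob cb] := Gc b Gb.
  have cf : closed (f b).
    have [Sb|nSb] := pselect (S b).
      suff -> : f b = b by [].
      by apply/seteqP; split => t; rewrite /f /= => bt; [apply/bt|split].
    suff -> : f b = ~` b by exact: open_closedC.
    by apply/seteqP; split => t; rewrite /f /= => bt; [move/bt|split].
  by apply: cf => B; apply: yP; exists (f b) => //; exact: finI_from1.
move=> D DG.
(* A finite set lists its elements without repetition, which supplies the distinctness demanded by
   condition (1). *)
pose s1 := [seq b <- D | `[< S b >]]; pose s2 := [seq b <- D | ~~ `[< S b >]].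
pose a (i : 'I_(size s1)) := tnth (in_tuple s1) i.
pose b (i : 'I_(size s2)) := tnth (in_tuple s2) i.
have aS i : S (a i) /\ G (a i).
  have := mem_tnth i (in_tuple s1); rewrite mem_filter => /andP[/asboolP ? iD].
  by split => //; apply: set_mem; exact: DG.
have bS i : ~ S (b i) /\ G (b i).
  have := mem_tnth i (in_tuple s2); rewrite mem_filter => /andP[/asboolPn ? iD].
  by split => //; apply: set_mem; exact: DG.
have ab : all_distinct a b.
  split.
  - by apply/tuple_uniqP; rewrite filter_uniq // fset_uniq.
  - by apply/tuple_uniqP; rewrite filter_uniq // fset_uniq.
  - by move=> i j E; have [] := bS j; rewrite -E; have [] := aS i.
have [h _] := iso _ _ a b (fun i => (aS i).2) (fun i => (bS i).2) ab.
have /set0P [y [ya yb]] : (\bigcap_i a i) `\` (\bigcup_j b j) != set0.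
  apply/eqP => /h E.
  have : ((\bigcap_i (phi (a i)).2) `\` (\bigcup_j (phi (b j)).1)) x.
    split; first by move=> i _; have [? ?] := aS i; exact: Sx.
    by move=> [j _]; have [? ?] := bS j; exact: nSx.
  by rewrite E.
exists y => c /= cD; rewrite /f /=.
have [Sc|nSc] := pselect (S c).
  have cs : c \in in_tuple s1 by rewrite mem_filter cD andbT; apply/asboolP.
  have /tnthP [i ci] := cs.
  by split => // _; rewrite ci; exact: ya.
have cs : c \in in_tuple s2 by rewrite mem_filter cD andbT; apply/asboolPn.
have /tnthP [i ci] := cs.
by split => // cy; exfalso; apply: yb; exists i => //; rewrite /b -ci.
Qed.

(** Without a gap, [(phi a).1 = (phi a).2] would be clopen, hence empty or all of [K]. Condition (2)
    for [a] alone, with [n = 1, m = 0] and with [n = 0, m = 1], excludes both. *)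
Lemma pseudoclopen_gap (L K : topologicalType) (G : set (set L))
    (H : set (set K * set K)) (phi : set L -> set K * set K) (a : set L) :
  connected [set: K] -> H `<=` @pseudoclopen K -> pseudoclopen_iso G H phi ->
  G a -> a <> set0 -> a <> [set: L] ->
  exists x, (phi a).2 x /\ ~ (phi a).1 x.
Proof.
move=> cK Hp [[phiH _ _] iso] Ga a0 aT.
have [ca oa sa] : pseudoclopen (phi a) by apply: Hp; exact: phiH.
pose c1 (i : 'I_1) := a.
pose c0 (i : 'I_0) : set L := a.
have n0 : (phi a).1 !=set0.
  have [] // := iso 1 0 c1 c0.
    by split=> [i j|[]//|i []//]; rewrite !ord1.
  move=> _ h; apply/set0P/eqP => E; apply: a0.
  apply/seteqP; split=> // t at_.
  have <- : (\bigcap_i c1 i) `\` (\bigcup_j c0 j) = set0.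
    by apply: h; apply/seteqP; split => // s [/(_ ord0 Logic.I)]; rewrite /c1 E.
  by split => // -[[]].
have nT : (phi a).2 <> [set: K].
  move=> E; have [] // := iso 0 1 c0 c1.
    by split=> [[]//|i j|[]//]; rewrite !ord1.
  move=> _ h; apply: aT; apply/seteqP; split=> // t _; apply: contrapT => nat_.
  have : ((\bigcap_i c0 i) `\` (\bigcup_j c1 j)) t by split => [[]//|[]].
  rewrite h //; apply/seteqP; split => // s [_]; apply; exists ord0 => //.
  by rewrite /c1 E.
apply: contrapT => nx.
have E : (phi a).1 = (phi a).2.
  apply/seteqP; split => // x x2; apply: contrapT => nx1.
  by apply: nx; exists x.
apply: nT; rewrite -E; apply: cK => //.
  by exists (phi a).2; rewrite // setTI.
by exists (phi a).1; rewrite // setTI.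
Qed.

(** A point [x] in the gap of [phi a] is compatible with both sides of [a], so it is realized twice
    in [L], with the same position relative to every other member of [G]. *)
Lemma boolean_image_adjacent (L K : topologicalType) (G : set (set L))
    (H : set (set K * set K)) (phi : set L -> set K * set K) (a : set L) :
  compact [set: L] -> connected [set: K] -> G `<=` clopen ->
  H `<=` @pseudoclopen K -> pseudoclopen_iso G H phi ->
  G a -> a <> set0 -> a <> [set: L] ->
  exists y z, [/\ a y, ~ a z & forall b, G b -> b <> a -> b y <-> b z].
Proof.
move=> cL cK Gc Hp iso Ga a0 aT.
have [x [x2 x1]] := pseudoclopen_gap cK Hp iso Ga a0 aT.
have sub b : G b -> (phi b).1 `<=` (phi b).2.
  by have [[phiH _ _] _] := iso => Gb; have [] := Hp _ (phiH b Gb).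
have [|b Gb nb|y yP] := @pseudoclopen_iso_realize L K G H phi x
  [set b | (phi b).2 x] cL Gc iso; first by [].
  by move/(sub b Gb).
have [b Gb [//]||z zP] := @pseudoclopen_iso_realize L K G H phi x
  [set b | (phi b).2 x /\ b <> a] cL Gc iso.
  move=> b Gb nb b1; apply: nb; split; first exact: sub.
  by move=> E; apply: x1; rewrite -E.
exists y, z; split; first by apply/yP.
  by move/(zP a Ga) => -[].
move=> b Gb ba; split; first by move/(yP b Gb) => b2; apply/zP.
by move/(zP b Gb) => -[b2 _]; apply/yP.
Qed.

(** * Infinite compact F-spaces and the special cases *)

Lemma F_space_not_boolean_image (L K : topologicalType) :
  compact [set: L] -> F_space L -> infinite_set [set: L] ->
  connected [set: K] -> ~ boolean_image L K.
Proof.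
move=> cL FL iL cK [G [H [phi [Gc sG Hp iso]]]].
(* The trivial members, to which the gap argument does not apply, are removed; infinitely many
   remain. *)
have iG : infinite_set (G `\` [set set0; [set: L]]).
  by apply: infinite_setD; [exact: separating_infinite|exact: finite_set2].
move/infiniteP: iG => /pcard_leP /injfunPex [a aG aI].
have aP n : G (a n) /\ a n <> set0 /\ a n <> [set: L].
  have [Ga na] := aG n Logic.I.
  by split => //; split => E; apply: na; rewrite E; [left|right].
have yz n : exists p : L * L, [/\ a n p.1, ~ a n p.2 &
    forall b, G b -> b <> a n -> b p.1 <-> b p.2].
  have [Ga [a0 aT]] := aP n.
  have [y [z ?]] := boolean_image_adjacent cL cK Gc Hp iso Ga a0 aT.
  by exists (y, z).
have [p pP] := choice yz.
apply: (@F_space_no_adjacent_pairs L G a (fun n => (p n).1) (fun n => (p n).2))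
  => //.
- by move=> m n; apply: aI; rewrite inE.
- by move=> n; have [] := aP n.
- by move=> n; have [] := pP n.
- by move=> n; have [] := pP n.
- by move=> n; have [] := pP n.
Qed.

Lemma cech_stone_nat_infinite (B : topologicalType) (e : nat -> B) :
  cech_stone e -> infinite_set [set: B].
Proof.
move=> [_ [_ ei _] _ _] fB; apply: infinite_nat.
rewrite -(preimage_setT e); apply: finite_preimage => //.
by move=> m n _ _; exact: ei.
Qed.

(** A one-point [L], with [G] empty, is a Boolean image of every nonempty [K]; hence the assumption
    that [L] is infinite. For the Cech-Stone compactification this follows from injectivity of
    [e]. *)
Theorem mainTheorem6 :
  [/\ forall L : topologicalType,
        compact_T2 L -> has_clopen_basis L -> F_space L ->
        infinite_set [set: L] ->
        forall K : topologicalType, compact_T2 K -> connected [set: K] ->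
          ~ boolean_image L K,
      forall (B : topologicalType) (e : nat -> B),
        cech_stone e ->
        forall K : topologicalType, compact_T2 K -> connected [set: K] ->
          ~ boolean_image B K
    & forall L : topologicalType,
        compact_T2 L -> extremally_disconnected L -> infinite_set [set: L] ->
        forall K : topologicalType, compact_T2 K -> connected [set: K] ->
          ~ boolean_image L K].
Proof.
split => [L [cL _] _ FL iL|B e Be|L [cL _] eL iL] K _ cK.
- exact: F_space_not_boolean_image.
- have [[cB _] _ _ _] := Be.
  apply: F_space_not_boolean_image => //; last exact: cech_stone_nat_infinite Be.
  apply: extremally_disconnected_F_space.
  exact: cech_stone_nat_extremally_disconnected Be.
- apply: F_space_not_boolean_image => //.
  exact: extremally_disconnected_F_space.
Qed.
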